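(* There is an absolute constant $C$ such that for all integers $n \ge 7$, $\mathrm{sat}^*(n,K_4) \le \frac{7}{2}n + C$ (that is, $\mathrm{sat}^*(n,K_4)\le\frac72 n+O(1)$).
   Context: All graphs are finite and simple. An edge-colouring of a graph is proper if incident edges receive different colours, and a subgraph is rainbow if all of its edges receive pairwise distinct colours. A graph $G$ is properly rainbow $H$-saturated if (1) there is a proper edge-colouring of $G$ (with any set of colours) containing no rainbow copy of $H$, and (2) for every edge $e$ of the complement $\overline{G}$, every proper edge-colouring of $G+e$ contains a rainbow copy of $H$. The proper rainbow saturation number $\mathrm{sat}^*(n,H)$ is the minimum number of edges in an $n$-vertex properly rainbow $H$-saturated graph. *)

(* Defs.v *)
From HB Require Import structures.
From mathcomp Require Import all_boot all_order all_algebra.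
From mathcomp Require Import boolp.

Set Implicit Arguments.
Unset Strict Implicit.
Unset Printing Implicit Defensive.

(* An edge is the two-element set of its ends. *)
Record sgraph (V : finType) := SGraph {
  edges : {set {set V}};
  edgesP : forall e, e \in edges -> #|e| = 2 }.

Section Graphs.
Variable V : finType.

Lemma complete_subproof (e : {set V}) :
  e \in [set e : {set V} | #|e| == 2] -> #|e| = 2.
Proof. by rewrite inE => /eqP. Qed.

Definition complete : sgraph V := SGraph complete_subproof.

Lemma compl_subproof (G : sgraph V) (e : {set V}) :
  e \in edges complete :\: edges G -> #|e| = 2.
Proof. by case/setDP => /edgesP. Qed.

Definition compl (G : sgraph V) : sgraph V := SGraph (@compl_subproof G).

Lemma add_edge_subproof (G : sgraph V) (e : {set V}) :
  forall f, f \in edges G :|: ([set e] :&: edges complete) -> #|f| = 2.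
Proof. by move=> f /setUP[/edgesP | /setIP[_ /edgesP]]. Qed.

(* G + e; intersecting with the complete graph only makes the definition total:
   nothing is added when e is not a pair of distinct vertices. *)
Definition add_edge (G : sgraph V) (e : {set V}) : sgraph V :=
  SGraph (@add_edge_subproof G e).

(* Colourings are total functions on vertex sets, of which only the values on
   edges are ever used. *)
Definition proper_colouring (K : Type) (G : sgraph V) (c : {set V} -> K) :=
  forall e f, e \in edges G -> f \in edges G ->
    e != f -> e :&: f != set0 -> c e <> c f.

(* A copy of H is the image of H under an injection of its vertices that sends
   edges to edges (not necessarily an induced subgraph). *)
Definition rainbow_copy (K : Type) (W : finType) (H : sgraph W)
    (G : sgraph V) (c : {set V} -> K) :=
  exists f : W -> V, [/\ injective f,
    forall e, e \in edges H -> f @: e \in edges G &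
    forall e e', e \in edges H -> e' \in edges H -> e != e' ->
      c (f @: e) <> c (f @: e')].

Definition rainbow_free_colourable (W : finType) (H : sgraph W)
    (G : sgraph V) :=
  exists (K : Type) (c : {set V} -> K),
    proper_colouring G c /\ ~ rainbow_copy H G c.

Definition properly_rainbow_saturated (W : finType) (H : sgraph W)
    (G : sgraph V) :=
  rainbow_free_colourable H G /\
  forall e, e \in edges (compl G) ->
    forall (K : Type) (c : {set V} -> K),
      proper_colouring (add_edge G e) c -> rainbow_copy H (add_edge G e) c.

End Graphs.

Arguments complete V : clear implicits.

Definition saturated_size (n : nat) (W : finType) (H : sgraph W) (m : nat) :=
  exists G : sgraph 'I_n,
    properly_rainbow_saturated H G /\ #|edges G| = m.

(* The default value 0 is not used when H has an edge, by sat_star_attained. *)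
Definition sat_star (n : nat) (W : finType) (H : sgraph W) : nat :=
  if pselect (exists m, `[< saturated_size n H m >]) is left ex
  then ex_minn ex else 0.

Lemma exists_saturated (n : nat) (W : finType) (H : sgraph W) :
  edges H != set0 ->
  exists G : sgraph 'I_n, properly_rainbow_saturated H G.
Proof.
case/set0Pn=> e0 He0.
pose P k := `[< exists G : sgraph 'I_n,
                  rainbow_free_colourable H G /\ #|edges G| = k >].
have exP : exists k, P k.
  have h0 (e : {set 'I_n}) : e \in set0 -> #|e| = 2 by rewrite inE.
  exists 0; apply/asboolP; exists (SGraph h0); split; last by rewrite cards0.
  exists unit, (fun=> tt); split; first by move=> e f; rewrite inE.
  by case=> f [_ /(_ _ He0)]; rewrite inE.
have ubP k : P k -> k <= #|{: {set 'I_n}}|.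
  by case/asboolP=> G [_ <-]; apply: max_card.
case: (ex_maxnP exP ubP) => k /asboolP[G [Gfree Gk]] kmax.
exists G; split=> // e eG K c cP; apply: contrapT => ncopy.
have : k.+1 <= k; last by rewrite ltnn.
apply: kmax; apply/asboolP; exists (add_edge G e); split; first by exists K, c.
have /setDP[eK enG] := eG.
rewrite -Gk /= (_ : [set e] :&: _ = [set e]).
  by rewrite setUC cardsU1 enG.
by apply/setIidPl; rewrite sub1set.
Qed.

Lemma sat_star_attained (n : nat) (W : finType) (H : sgraph W) :
  edges H != set0 -> saturated_size n H (sat_star n H).
Proof.
move=> /(exists_saturated n)[G GP]; rewrite /sat_star.
case: pselect => [ex | []]; first by case: ex_minnP => m /asboolP.
by exists #|edges G|; apply/asboolP; exists G.
Qed.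

Lemma sat_star_min (n : nat) (W : finType) (H : sgraph W) (G : sgraph 'I_n) :
  properly_rainbow_saturated H G -> sat_star n H <= #|edges G|.
Proof.
move=> GP; rewrite /sat_star; case: pselect => // ex.
by case: ex_minnP => m _; apply; apply/asboolP; exists G.
Qed.

(* Main.v *)
(* Glue copies of K_6 along a common edge: about n/4 copies, each with 14 edges
   besides the shared one, give 7n/2 edges in all.  In a rainbow-K_4-free proper
   colouring of K_6, each of the 15 copies of K_4 has two disjoint edges of equal
   colour, while each colour class has at most 3 edges and so at most 3 pairs;
   hence the 15 edges fall into five perfect matchings.  An edge xy between two
   different copies joins y to three vertices of a K_6, namely x and the shared
   edge; in the K_4 that these span, an edge at y would have to repeat the
   colour of the opposite edge, whose perfect matching already meets its other
   end.  Conversely a 1-factorization of K_6 colours every copy, with colours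
   told apart between the copies except for the factor of the shared edge. *)
Require Import Defs.
From mathcomp Require Import all_boot all_order all_algebra.
From mathcomp Require Import boolp zify lra.

Import Order.TTheory GRing.Theory Num.Theory.
Local Open Scope ring_scope.

Set Implicit Arguments.
Unset Strict Implicit.
Unset Printing Implicit Defensive.

Local Open Scope nat_scope.

(** * Proper colourings of K_6 without a rainbow K_4 *)

Definition clique (V : finType) (G : sgraph V) (S : {set V}) :=
  forall e : {set V}, e \subset S -> #|e| = 2 -> e \in edges G.

Lemma nonrainbow_clique4 (V : finType) (K : Type) (G : sgraph V)
    (c : {set V} -> K) (q : {set V}) :
  ~ rainbow_copy (complete 'I_4) G c -> clique G q -> #|q| = 4 ->
  exists e f : {set V}, [/\ e \subset q, f \subset q, #|e| = 2, #|f| = 2 &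
    e != f /\ c e = c f].
Proof.
move=> nrb qG q4; apply: contrapT => nex; apply: nrb.
pose f (i : 'I_4) : V := enum_val (cast_ord (esym q4) i).
have injf : injective f by move=> i j /enum_val_inj /cast_ord_inj.
have fq (e : {set 'I_4}) : f @: e \subset q.
  by apply/subsetP=> _ /imsetP[i _ ->]; apply: enum_valP.
have f2 (e : {set 'I_4}) : e \in edges (complete 'I_4) -> #|f @: e| = 2.
  by rewrite inE card_imset // => /eqP.
exists f; split=> // [e He|e e' He He' nee' cee']; first exact: qG (f2 _ He).
apply: nex; exists (f @: e), (f @: e'); split; rewrite ?fq ?f2 //.
by split=> //; apply: contraNneq nee' => /(imset_inj injf) ->.
Qed.

Lemma clique6_perfect_matching (V : finType) (K : Type) (G : sgraph V)
    (c : {set V} -> K) (S e : {set V}) (v : V) :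
  proper_colouring G c -> ~ rainbow_copy (complete 'I_4) G c ->
  clique G S -> #|S| = 6 -> e \subset S -> #|e| = 2 -> v \in S ->
  exists f : {set V}, [/\ f \subset S, #|f| = 2, v \in f & c f = c e].
Proof.
move=> prop nrb SG S6 eS e2 vS.
pose D := [set e : {set V} | (e \subset S) && (#|e| == 2)].
pose Q := [set e : {set V} | (e \subset S) && (#|e| == 4)].
pose F (e : {set V}) := [set f in D | `[< c f = c e >]].
have D15 : #|D| = 15 by rewrite cards_draws S6.
have Q15 : #|Q| = 15 by rewrite cards_draws S6.
have DP f : f \in D -> [/\ f \subset S, #|f| = 2 & f \in edges G].
  by rewrite inE => /andP[fS /eqP f2]; split=> //; apply: SG.
have disj f g : f \in D -> g \in D -> f != g -> c f = c g -> [disjoint f & g].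
  move=> /DP[_ _ fG] /DP[_ _ gG] fg cfg; rewrite -setI_eq0.
  by apply: contrapT => /negP fIg; apply: (prop f g).
have cardF f : #|F f| * 2 = #|cover (F f)|.
  have /eqP <- : trivIset (F f).
    apply/trivIsetP => A B /setIdP[AD /asboolP cA] /setIdP[BD /asboolP cB] AB.
    by apply: disj; rewrite // cA cB.
  rewrite -sum_nat_const; apply: eq_bigr => g; case/setIdP=> gD _.
  by case: (DP g gD).
have coverF f : cover (F f) \subset S.
  by apply/bigcupsP => g /setIdP[/DP[]].
have F3 f : #|F f| <= 3.
  by have := subset_leq_card (coverF f); rewrite S6 -cardF; lia.
(* Every 4-subset of S is the union of a pair in P, in both orders. *)
pose P := [set p : {set V} * {set V} | (p.1 \in D) && (p.2 \in F p.1 :\ p.1)].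
have P30 : 30 <= #|P|.
  rewrite -[#|P|]sum1_card (partition_big (fun p => p.1 :|: p.2) (mem Q)) /=.
    have -> : 30 = \sum_(q in Q) 2 by rewrite sum_nat_const Q15.
    apply: leq_sum => q; rewrite inE => /andP[qS /eqP q4].
    have qG : clique G q by move=> f fq; apply: SG; apply: subset_trans qS.
    have [f [g [fq gq f2 g2 [fg cfg]]]] := nonrainbow_clique4 nrb qG q4.
    have fD : f \in D by rewrite inE (subset_trans fq) ?f2.
    have gD : g \in D by rewrite inE (subset_trans gq) ?g2.
    have fgq : f :|: g = q.
      apply/eqP; rewrite eqEcard subUset fq gq /= q4 cardsU f2 g2.
      by have := disj _ _ fD gD fg cfg; rewrite -setI_eq0 => /eqP ->; rewrite cards0.
    rewrite sum1dep_card (leq_trans (n := #|[set (f, g); (g, f)]|)) //.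
      by rewrite cards2 xpair_eqE negb_and fg.
    apply/subset_leq_card/subsetP => p; rewrite !inE /= -/(F _).
    move: fD gD; rewrite !inE => fD gD.
    case/orP=> /eqP-> /=; rewrite ?[g :|: f]setUC fgq fD gD eqxx andbT /=.
      by rewrite eq_sym fg asboolT.
    by rewrite fg asboolT.
  case=> f g; rewrite !inE /= => /andP[/andP[fS /eqP f2]].
  case/and3P=> gf /andP[gS /eqP g2] /asboolP cgf.
  have : [disjoint f & g].
    by apply: disj; rewrite ?inE ?fS ?gS ?f2 ?g2 // eq_sym.
  rewrite subUset fS gS cardsU f2 g2 -setI_eq0 => /eqP ->.
  by rewrite cards0.
have sumP : #|P| = \sum_(f in D) #|F f :\ f|.
  rewrite -sum1_card (eq_bigr (fun f => \sum_(g in F f :\ f) 1)); last first.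
    by move=> f _; rewrite sum1_card.
  by rewrite pair_big_dep; apply: eq_bigl => p; rewrite inE.
(* The 15 edges share the at least 30 ordered pairs of [P], at most 2 each, so no edge can fall
   short; 28 is the most that the 14 edges other than [e] account for. *)
have Fe3 : #|F e| = 3.
  have eD : e \in D by rewrite inE eS e2.
  have FF f : f \in D -> #|F f| = (#|F f :\ f|).+1.
    move=> fD; rewrite (cardsD1 f) -add1n; congr (_ + _).
    by rewrite inE fD asboolT.
  have sum28 : \sum_(f in D | f != e) #|F f :\ f| <= 28.
    apply: (@leq_trans (\sum_(f in D | f != e) 2)).
      by apply: leq_sum => f /andP[fD _]; rewrite -ltnS -FF.
    rewrite sum_nat_const (_ : #|_| = 14) //.
    have [->] : 15 = (#|D :\ e|).+1 by rewrite -D15 (cardsD1 e) eD.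
    by apply: eq_card => f; rewrite in_setD1 andbC.
  have Fe2 : 2 <= #|F e :\ e|.
    rewrite -(leq_add2r 28); apply: leq_trans P30 _.
    by rewrite sumP (bigD1 e) //= leq_add2l.
  by apply/eqP; rewrite eqn_leq F3 FF.
have /eqP covS : cover (F e) == S by rewrite eqEcard coverF -cardF Fe3 S6.
have : v \in cover (F e) by rewrite covS.
case/bigcupP => f /setIdP[/DP[fS f2 _] /asboolP cf] vf.
by exists f.
Qed.

Lemma clique6_attach3 (V : finType) (K : Type) (G : sgraph V)
    (c : {set V} -> K) (S T : {set V}) (y : V) :
  proper_colouring G c -> clique G S -> #|S| = 6 ->
  y \notin S -> T \subset S -> #|T| = 3 -> clique G (y |: T) ->
  rainbow_copy (complete 'I_4) G c.
Proof.
move=> prop SG S6 yS TS T3 TG; apply: contrapT => nrb.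
have yT : y \notin T by apply: contra yS; apply: subsetP.
have q4 : #|y |: T| = 4 by rewrite cardsU1 yT T3.
have sub (f : {set V}) : f \subset y |: T -> y \notin f -> f \subset T.
  move=> fT yf; apply/subsetP => z zf; move: (subsetP fT z zf).
  by rewrite !inE => /predU1P[zy|//]; rewrite -zy zf in yf.
(* If an edge [h] at [y] repeats the colour of an edge [g] of [T], the perfect matching of that
   colour has an edge inside [S] at the other end [w] of [h], against properness. *)
have key (g h : {set V}) : g \subset T -> #|g| = 2 -> y \in h -> h \subset y |: T ->
    #|h| = 2 -> c g = c h -> False.
  move=> gT g2 yh hT h2 cgh.
  have : 0 < #|h :\ y| by move: (cardsD1 y h); rewrite yh h2 add1n => -[<-].
  case/card_gt0P => w; rewrite !inE => /andP[wy wh].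
  have wS : w \in S.
    apply: (subsetP TS); move: (subsetP hT w wh).
    by rewrite !inE (negbTE wy).
  have [f [fS f2 wf cf]] := clique6_perfect_matching prop nrb SG S6
    (subset_trans gT TS) g2 wS.
  apply: (prop f h); last by rewrite cf.
  - exact: SG.
  - exact: TG.
  - by apply: contraNneq yS => fh; apply: (subsetP fS); rewrite fh.
  - by apply/set0Pn; exists w; rewrite inE wf.
have [e [f [eq fq e2 f2 [ef cef]]]] := nonrainbow_clique4 nrb TG q4.
(* Two edges that both contain [y], or both lie in the triangle [T], meet and so differ in colour;
   [key] settles the two mixed cases. *)
have [ye|ye] := boolP (y \in e); last first.
  have [yf|yf] := boolP (y \in f); first exact: (key e f) (sub _ eq ye) _ _ _ _ _.
  have := subset_leq_card (introT subUsetP (conj (sub _ eq ye) (sub _ fq yf))).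
  rewrite T3 cardsU e2 f2.
  suff /eqP -> : e :&: f == set0 by rewrite cards0.
  by apply: contrapT => /negP fIg; apply: (prop e f); rewrite // TG.
have [yf|yf] := boolP (y \in f); last exact: (key f e) (sub _ fq yf) _ _ _ _ _.
by apply: (prop e f) => //; [exact: TG|exact: TG|apply/set0Pn; exists y; rewrite inE ye].
Qed.

(** * The graph: copies of K_6 through a common edge *)

(** Block 0 is the hub {0, 1}, the shared edge; each later block consists of four consecutive
    vertices, which span a K_6 with the hub. *)
Definition block (v : nat) := (v + 2) %/ 4.

Definition joined (u v : nat) :=
  [|| block u == 0, block v == 0 | block u == block v].

Lemma bouquet_subproof (n : nat) (e : {set 'I_n}) :
  e \in [set e : {set 'I_n} | (#|e| == 2) &&
           [forall u in e, forall v in e, joined u v]] -> #|e| = 2.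
Proof. by rewrite inE => /andP[/eqP]. Qed.

(* Copies of K_6 sharing the edge {0, 1}; the last copy may be truncated. *)
Definition bouquet (n : nat) : sgraph 'I_n := SGraph (@bouquet_subproof n).

Lemma bouquetP (n : nat) (e : {set 'I_n}) :
  reflect (#|e| = 2 /\ {in e &, forall u v : 'I_n, joined u v})
          (e \in edges (bouquet n)).
Proof.
rewrite inE; apply: (iffP andP) => -[e2 eJ]; split.
- exact/eqP.
- by move=> u v ue ve; move/forall_inP: eJ => /(_ u ue)/forall_inP/(_ v ve).
- exact/eqP.
- by apply/forall_inP => u ue; apply/forall_inP => v ve; apply: eJ.
Qed.

Definition petal_vertex (t i : nat) := if i < 2 then i else 4 * t.-1 + i.

(** In a truncated last block [inord] sends positions beyond the last vertex to vertex 0, so the set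
    may have fewer than six elements. *)
Definition petal (n t : nat) : {set 'I_n.+1} :=
  [set inord (petal_vertex t (i : 'I_6)) | i : 'I_6].

Lemma mem_petal (n t : nat) (v : 'I_n.+1) :
  (block v == 0) || (block v == t) -> v \in petal n t.
Proof.
rewrite /block => Hv; pose k := if v < 2 then v : nat else v - 4 * t.-1.
have k6 : k < 6 by rewrite /k; case: ifP; lia.
apply/imsetP; exists (Ordinal k6) => //; apply/val_inj; rewrite /= inordK.
  by rewrite /petal_vertex /k; do !case: ifP; lia.
by have := ltn_ord v; rewrite /petal_vertex /k; do !case: ifP; lia.
Qed.

(** Vertices are numbered block by block, so every block before that of an actual vertex [y] is
    complete. *)
Lemma petal_full (n t : nat) (y : 'I_n.+1) :
  0 < t < block y ->
  [/\ #|petal n t| = 6, y \notin petal n t &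
      {in petal n t, forall v : 'I_n.+1, (block v == 0) || (block v == t)}].
Proof.
rewrite /block => ty; have yn := ltn_ord y.
have pv (i : 'I_6) : petal_vertex t i < n.+1 /\ petal_vertex t i < y.
  by have := ltn_ord i; rewrite /petal_vertex; case: ifP; lia.
split.
- rewrite card_imset ?card_ord // => i j /(congr1 val).
  rewrite /= !inordK ?(pv _).1 // => ij; apply/val_inj; move: ij => /=.
  by have := ltn_ord i; have := ltn_ord j; rewrite /petal_vertex; do !case: ifP; lia.
- apply/imsetP => -[i _ /(congr1 val)]; rewrite /= inordK ?(pv _).1 //.
  by case: (pv i); lia.
- move=> _ /imsetP[i _ ->]; rewrite inordK ?(pv _).1 // /block.
  by have := ltn_ord i; rewrite /petal_vertex; case: ifP; lia.
Qed.

(** * Adding a missing edge *)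

Lemma bouquet_forced (n : nat) (K : Type) (e : {set 'I_n.+2})
    (c : {set 'I_n.+2} -> K) :
  e \in edges (compl (bouquet n.+2)) ->
  proper_colouring (add_edge (bouquet n.+2) e) c ->
  rainbow_copy (complete 'I_4) (add_edge (bouquet n.+2) e) c.
Proof.
case/setDP; rewrite inE => /cards2P[x [y [xy ->]]] enG prop.
have : ~~ joined x y.
  apply: contra enG => Jxy; apply/bouquetP; split; first by rewrite cards2 xy.
  by move=> u v /set2P[] -> /set2P[] ->; move: Jxy; rewrite /joined; lia.
(* The end in the earlier block is taken as [x]: its petal is complete, while that of [y] may be
   truncated. *)
wlog ltxy : x y xy enG prop / block x < block y => [WL|] Jxy.
  have [ltxy|] := ltnP (block x) (block y); first exact: WL.
  rewrite leq_eqVlt => /orP[|ltyx]; first by move: Jxy; rewrite /joined; lia.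
  move: enG prop Jxy; rewrite setUC => enG prop Jxy.
  by apply: WL; rewrite 1?eq_sym //; move: Jxy; rewrite /joined; lia.
have x0 : 0 < block x < block y by move: Jxy; rewrite /joined; lia.
have [S6 yS SP] := petal_full x0.
set S := petal _ _ in S6 yS SP.
pose a : 'I_n.+2 := ord0; pose b : 'I_n.+2 := inord 1.
have b1 : b = 1 :> nat by rewrite inordK.
have b0 : block b = 0 by rewrite b1.
have xb : b != x by apply: contraTneq x0 => <-; rewrite b0.
have xa : a != x by apply: contraTneq x0 => <-.
have ab : a != b by rewrite -val_eqE /= b1.
have subG f : f \in edges (bouquet n.+2) ->
    f \in edges (add_edge (bouquet n.+2) [set x; y]).
  by move=> fG; apply/setUP; left.
apply: (@clique6_attach3 _ _ _ _ S [set a; b; x] y) => //.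
- move=> f fS f2; apply: subG; apply/bouquetP; split=> // u v uf vf.
  have := SP u (subsetP fS _ uf); have := SP v (subsetP fS _ vf).
  by rewrite /joined; lia.
- by apply/subsetP => z; rewrite !inE => /orP[/orP[]|] /eqP ->;
    apply: mem_petal; rewrite ?b0 ?eqxx ?orbT.
- by rewrite setUC cardsU1 !inE cards2 ab eq_sym (negPf xa) eq_sym (negPf xb).
(* Since [a] and [b] form the hub, {x, y} is the only pair in {y, a, b, x} missing from the
   bouquet. *)
- move=> f fq f2.
  have [->|fxy] := eqVneq f [set x; y].
    by rewrite !inE eqxx cards2 xy orbT.
  apply: subG; apply/bouquetP; split=> // u v uf vf.
  apply: contraNT fxy => Juv; rewrite eq_sym eqEcard f2 cards2 xy andbT.
  have a0 : block a = 0 by [].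
  move: uf vf Juv (subsetP fq _ uf) (subsetP fq _ vf); rewrite !inE -!orbA.
  by move=> uf vf Juv /or4P[] /eqP uE /or4P[] /eqP vE; move: uf vf Juv;
     rewrite uE vE => uf vf;
     rewrite /joined ?a0 ?b0 ?eqxx ?orbT //= subUset !sub1set uf vf.
Qed.

(** * A colouring of the bouquet without a rainbow K_4 *)

(** The position of a vertex in its copy of K_6: 4 and 5 for the hub, 0 to 3 for the others. *)
Definition slot (v : nat) := if v < 2 then v + 4 else (v + 2) %% 4.

(* The round-robin 1-factorization of K_6, with 5 as the point at infinity. *)
Definition round (p q : nat) :=
  (if p == 5 then q + q else if q == 5 then p + p else p + q) %% 5.

(* 3 is the round of the shared edge {0, 1}, whose slots are 4 and 5. *)
Definition pair_colour (u v : nat) :=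
  let k := round (slot u) (slot v) in
  (if k == 3 then 0 else maxn (block u) (block v), k).

(** Which ordering of the pair is picked is immaterial, as [pair_colour] is symmetric; [(0, 0)] is a
    default for sets that are not pairs. *)
Definition bouquet_colour (n : nat) (e : {set 'I_n}) : nat * nat :=
  if [pick p : 'I_n * 'I_n | (p.1 != p.2) && (e == [set p.1; p.2])] is Some p
  then pair_colour p.1 p.2 else (0, 0).

Lemma pair_colourC (u v : nat) : pair_colour u v = pair_colour v u.
Proof.
rewrite /pair_colour maxnC (_ : round _ _ = round (slot v) (slot u)) //.
by rewrite /round addnC; do 2!case: eqP => // ->.
Qed.

Lemma bouquet_colourE (n : nat) (u v : 'I_n) :
  u != v -> bouquet_colour [set u; v] = pair_colour u v.
Proof.
move=> uv; rewrite /bouquet_colour; case: pickP => [[x y] /= /andP[xy /eqP E]|].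
  have := set21 u v; have := set22 u v; rewrite E !inE.
  case/orP=> /eqP vE /orP[] /eqP uE; subst => //.
  - by rewrite eqxx in uv.
  - exact: pair_colourC.
  - by rewrite eqxx in uv.
by move/(_ (u, v)); rewrite /= uv eqxx.
Qed.

Lemma slot_lt6 (v : nat) : slot v < 6.
Proof. by rewrite /slot; case: ifP; lia. Qed.

Lemma slot_inj (u v : nat) : joined u v -> slot u = slot v -> u = v.
Proof. by rewrite /joined /block /slot; do 2!case: ifP; lia. Qed.

Lemma slot_hub (v : nat) : (4 <= slot v) = (block v == 0).
Proof. by rewrite /slot /block; case: ifP; lia. Qed.

Lemma round_inj (p q r : nat) : p < 6 -> q < 6 -> r < 6 ->
  p != q -> p != r -> round p q = round p r -> q = r.
Proof.
have : all (fun p => all (fun q => all (fun r =>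
    [==> p != q, p != r, round p q == round p r => q == r])
  (iota 0 6)) (iota 0 6)) (iota 0 6) by vm_compute.
move=> /allP H p6 q6 r6 pq pr E.
move: (H p); rewrite mem_iota => /(_ p6)/allP/(_ q).
rewrite mem_iota => /(_ q6)/allP/(_ r); rewrite mem_iota => /(_ r6).
by rewrite pq pr E eqxx => /eqP.
Qed.

(** Round 3 matches the slots 4 and 5 of the hub with each other. *)
Lemma round_hub (p q : nat) : 4 <= p < 6 -> q < 6 -> p != q ->
  round p q = 3 -> 4 <= q.
Proof.
by move: p q => [|[|[|[|[|[|p]]]]]] [|[|[|[|[|[|q]]]]]].
Qed.

(** The two slots outside the K_4 form an edge, and the other two edges of its factor lie inside the
    K_4. *)
Lemma round_K4 (p q r s : nat) : p < 6 -> q < 6 -> r < 6 -> s < 6 ->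
  uniq [:: p; q; r; s] ->
  [|| round p q == round r s, round p r == round q s | round p s == round q r].
Proof.
have : all (fun p => all (fun q => all (fun r => all (fun s =>
    uniq [:: p; q; r; s] ==> [|| round p q == round r s,
      round p r == round q s | round p s == round q r])
  (iota 0 6)) (iota 0 6)) (iota 0 6)) (iota 0 6) by vm_compute.
move=> /allP H p6 q6 r6 s6.
move: (H p); rewrite mem_iota => /(_ p6)/allP/(_ q).
rewrite mem_iota => /(_ q6)/allP/(_ r); rewrite mem_iota => /(_ r6)/allP/(_ s).
by rewrite mem_iota => /(_ s6)/implyP.
Qed.

Lemma pair_colour_inj (u v w : nat) : u != v -> u != w ->
  joined u v -> joined u w -> pair_colour u v = pair_colour u w -> v = w.
Proof.
move=> uv uw Juv Juw [tagE kE].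
have suv : slot u != slot v by apply: contra_neq uv; apply: slot_inj.
have suw : slot u != slot w by apply: contra_neq uw; apply: slot_inj.
have svw := round_inj (slot_lt6 u) (slot_lt6 v) (slot_lt6 w) suv suw kE.
(* It remains to put [v] and [w] in one copy of K_6. If [u] is off the hub, it is the copy of [u].
   If [u] is in the hub, round 3 leads back into the hub, and in other rounds the equal tags are the
   blocks of [v] and [w]. *)
apply: slot_inj => //; move: tagE Juv Juw; rewrite /joined -kE.
have := slot_hub u; have := slot_hub v; have := slot_hub w; rewrite -svw.
have h : round (slot u) (slot v) = 3 -> 4 <= slot u -> 4 <= slot v.
  by move=> k3 u4; apply: round_hub k3; rewrite ?slot_lt6 ?u4.
case: (round _ _ =P 3) => [/h|_]; lia.
Qed.

(** Four mutually joined vertices lie in one copy of K_6. Outside round 3 each edge has an end off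
    the hub, and all such ends share a block, so the tags agree. *)
Lemma pair_colour_eq (u v w x : nat) : uniq [:: u; v; w; x] ->
  {in [:: u; v; w; x] &, forall y z, joined y z} ->
  round (slot u) (slot v) = round (slot w) (slot x) ->
  pair_colour u v = pair_colour w x.
Proof.
move=> /= /and3P[]; rewrite !inE !negb_or => /and3P[uv _ _] _ /andP[wx _] J kE.
have hub y z : y != z -> joined y z -> round (slot y) (slot z) != 3 ->
    (0 < block y) || (0 < block z).
  move=> yz Jyz; apply: contraR; rewrite negb_or -!eqn0Ngt -!slot_hub.
  case/andP=> sy sz; have {yz} : slot y != slot z.
    by apply: contra_neq yz; apply: slot_inj.
  move: sy sz (slot_lt6 y) (slot_lt6 z).
  by case: (slot y) (slot z) => [|[|[|[|[|[|?]]]]]] [|[|[|[|[|[|?]]]]]].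
have Juv : joined u v by apply: J; rewrite !inE eqxx ?orbT.
have Jwx : joined w x by apply: J; rewrite !inE eqxx ?orbT.
have Juw : joined u w by apply: J; rewrite !inE eqxx ?orbT.
have Jux : joined u x by apply: J; rewrite !inE eqxx ?orbT.
have Jvw : joined v w by apply: J; rewrite !inE eqxx ?orbT.
have Jvx : joined v x by apply: J; rewrite !inE eqxx ?orbT.
have := hub u v uv Juv; have := hub w x wx Jwx.
rewrite /pair_colour kE; case: eqP => //= _ /(_ isT) bwx /(_ isT) buv.
congr (_, _); move: Juv Jwx Juw Jux Jvw Jvx bwx buv; rewrite /joined; lia.
Qed.

Lemma bouquet_proper (n : nat) :
  proper_colouring (bouquet n) (@bouquet_colour n).
Proof.
move=> e f /bouquetP[e2 eJ] /bouquetP[f2 fJ] ef /set0Pn[u /setIP[ue uf]].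
have other (g : {set 'I_n}) : #|g| = 2 -> u \in g ->
    exists2 v, u != v & g = [set u; v].
  move=> /eqP/cards2P[x [y [xy ->]]] /set2P[] ->; first by exists y.
  by exists x; rewrite 1?eq_sym 1?setUC.
have [v uv eE] := other e e2 ue; have [w uw fE] := other f f2 uf.
rewrite eE fE !bouquet_colourE // => /pair_colour_inj vw.
case/eqP: ef; rewrite eE fE; congr [set _; _]; apply/val_inj/vw => //.
  by apply: eJ; rewrite // eE set22.
by apply: fJ; rewrite // fE set22.
Qed.

Lemma bouquet_rainbow_free (n : nat) :
  ~ rainbow_copy (complete 'I_4) (bouquet n) (@bouquet_colour n).
Proof.
case=> f [injf fE frb].
have im2 i j : f @: [set i; j] = [set f i; f j] by rewrite imsetU1 imset_set1.
have J i j : joined (f i) (f j).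
  have [->|ij] := eqVneq i j; first by rewrite /joined eqxx !orbT.
  have /bouquetP[_] : f @: [set i; j] \in edges (bouquet n).
    by apply: fE; rewrite inE cards2 ij.
  by apply; rewrite im2 !inE eqxx ?orbT.
(* In a rainbow copy, opposite edges would lie in different rounds for all three pairings, against
   [round_K4]. *)
have rb i j k l : uniq [:: i; j; k; l] ->
    round (slot (f i)) (slot (f j)) != round (slot (f k)) (slot (f l)).
  move=> U; apply/eqP => rE.
  have /and3P[] := U; rewrite !inE !negb_or => /and3P[ij ik il] _ /andP[kl _].
  apply: (frb [set i; j] [set k; l]); rewrite ?inE ?cards2 ?ij ?kl //.
    apply/eqP => E; have := set21 i j.
    by rewrite E !inE (negPf ik) (negPf il).
  rewrite !im2 !bouquet_colourE ?(inj_eq injf) //; apply: pair_colour_eq => //.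
    by rewrite -(map_inj_uniq injf) -(map_inj_uniq val_inj) /= in U.
  move=> y z; rewrite !inE.
  by case/or4P => /eqP -> /or4P[] /eqP ->; apply: J.
pose i0 : 'I_4 := ord0; pose i1 : 'I_4 := inord 1.
pose i2 : 'I_4 := inord 2; pose i3 : 'I_4 := inord 3.
have U : uniq [:: i0; i1; i2; i3].
  by rewrite -(map_inj_uniq val_inj) /= !inordK.
have Us : uniq [seq slot (f i) | i <- [:: i0; i1; i2; i3]].
  by rewrite map_inj_uniq // => i j /(slot_inj (J i j))/val_inj/injf.
have := round_K4 (slot_lt6 _) (slot_lt6 _) (slot_lt6 _) (slot_lt6 _) Us.
by rewrite !(negPf (rb _ _ _ _ _)) // -(map_inj_uniq val_inj) /= !inordK.
Qed.

(** * Saturation and the number of edges *)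

Lemma bouquet_saturated (n : nat) :
  properly_rainbow_saturated (complete 'I_4) (bouquet n.+2).
Proof.
split; last by move=> e eG K c; apply: bouquet_forced.
exists (nat * nat)%type, (@bouquet_colour n.+2); split.
  exact: bouquet_proper.
exact: bouquet_rainbow_free.
Qed.

(** A degree count: a vertex off the hub has all its neighbours in its petal, which has at most six
    vertices. *)
Lemma bouquet_size (n : nat) : 2 * #|edges (bouquet n.+2)| <= 7 * n.+2.
Proof.
pose E := edges (bouquet n.+2).
pose N (v : 'I_n.+2) := [set w | (w != v) && joined v w].
have degree v : #|[set e in E | v \in e]| <= #|N v|.
  apply: leq_trans (leq_imset_card (fun w => [set v; w]) _).
  apply/subset_leq_card/subsetP => e; rewrite inE => /andP[/bouquetP[e2 eJ] ve].
  have /eqP/cards2P[x [y [xy eE]]] := e2; move: ve eJ; rewrite eE.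
  case/set2P=> -> J; apply/imsetP.
    by exists y; rewrite // inE eq_sym xy J ?set21 ?set22.
  by exists x; rewrite 1?setUC // inE xy J ?set21 ?set22.
have N5 (v : 'I_n.+2) : 0 < block v -> #|N v| <= 5.
  move=> v0; have p6 : #|petal n.+1 (block v)| <= 6.
    by rewrite (leq_trans (leq_imset_card _ _)) ?card_ord.
  rewrite -ltnS; apply: leq_trans p6.
  apply: (@leq_trans #|v |: N v|); first by rewrite cardsU1 !inE eqxx.
  apply/subset_leq_card/subsetP => w; rewrite !inE => Hw.
  apply: mem_petal; case/predU1P: Hw => [->|/andP[_]]; first by rewrite eqxx orbT.
  by rewrite /joined (gtn_eqF v0) [block v == _]eq_sym.
have -> : 2 * #|E| = \sum_v #|[set e in E | v \in e]|.
  transitivity (\sum_(e in E) \sum_(v in e) 1).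
    rewrite mulnC -sum_nat_const; apply: eq_bigr => e /bouquetP[e2 _].
    by rewrite sum1_card.
  rewrite (exchange_big_dep predT) //=; apply: eq_bigr => v _.
  by rewrite sum1dep_card.
(* The two hub vertices get the crude bound n + 2 and the n others 5, which makes 7n + 4 in all. *)
rewrite (@leq_trans (\sum_(v < n.+2) if v < 2 then n.+2 else 5)) //.
  apply: leq_sum => v _; apply: leq_trans (degree v) _.
  case: ltnP => v2; first by rewrite -[leqRHS]card_ord max_card.
  by apply: N5; rewrite /block; lia.
by rewrite !big_ord_recl /= sum_nat_const card_ord; lia.
Qed.

Local Close Scope nat_scope.

Theorem theorem1p2 :
  exists C : rat, forall n : nat, (7 <= n)%N ->
    (sat_star n (complete 'I_4))%:R <= 7%:R / 2%:R * n%:R + C.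
Proof.
(* The degree count leaves no error term, hence the constant 0. *)
exists 0 => -[|[|n]] // _.
have := leq_trans (leq_mul (leqnn 2) (sat_star_min (bouquet_saturated n)))
  (bouquet_size n).
rewrite -(ler_nat rat) !natrM; lra.
Qed.
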